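(* Let $\psi_{33},\psi_{34}=\psi_{43},\psi_{44}$ be smooth real-valued functions on $\mathbb{R}^4$ which depend only on the coordinates $(x_3,x_4)$, i.e. $\psi_{ij}=\psi_{ij}(x_3,x_4)$. Let $\mathcal{M}=(\mathbb{R}^4,g)$, where $g$ is the pseudo-Riemannian metric of signature $(2,2)$ whose (possibly) non-zero components, up to symmetry, are $$g(\partial_1,\partial_3)=g(\partial_2,\partial_4)=1,\qquad g(\partial_i,\partial_j)=\psi_{ij}\ \text{ for } i,j\in\{3,4\}.$$ Then $\mathcal{M}$ is nilpotent Osserman and geodesically complete.
   Context: $(x_1,x_2,x_3,x_4)$ are the standard coordinates on $\mathbb{R}^4$ and $\partial_i=\partial/\partial x_i$. Let $\nabla$ be the Levi-Civita connection of $g$, let $\mathcal{R}(x,y)=\nabla_x\nabla_y-\nabla_y\nabla_x-\nabla_{[x,y]}$ be the curvature operator, and for a tangent vector $x$ let $\mathcal{J}(x):y\mapsto\mathcal{R}(y,x)x$ be the Jacobi operator. A pseudo-Riemannian manifold $\mathcal{M}$ is nilpotent Osserman if, for every tangent vector $x$, $\mathcal{J}(x)$ has only the eigenvalue $0$, equivalently $\mathcal{J}(x)^{\dim M}=0$. It is geodesically complete if all geodesics exist for all time (extend to parameter domain $\mathbb{R}$). *)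

(* Defs.v *)
From HB Require Import structures.
From mathcomp Require Import all_boot all_order all_algebra.
From mathcomp Require Import all_classical all_reals all_analysis.
From mathcomp Require Import ring lra.
From mathcomp.real_closed Require Import complex.

Set Implicit Arguments.
Unset Strict Implicit.
Unset Printing Implicit Defensive.

Import Order.TTheory GRing.Theory Num.Theory.
Import numFieldNormedType.Exports.

Local Open Scope classical_set_scope.
Local Open Scope ring_scope.

Section Smooth.
Variables (R : realType) (n : nat).

Definition coord_vec (i : 'I_n) : 'rV[R]_n := delta_mx 0 i.

Definition partial (i : 'I_n) (f : 'rV[R]_n -> R) : 'rV[R]_n -> R :=
  fun p => 'D_(coord_vec i) f p.

Fixpoint class_C (k : nat) (f : 'rV[R]_n -> R) : Prop :=
  match k with
  | 0 => continuous f
  | k'.+1 => (forall p, differentiable f p) /\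
             (forall i, class_C k' (partial i f))
  end.

Definition smooth (f : 'rV[R]_n -> R) : Prop := forall k, class_C k f.

Lemma smooth_cst (c : R) : smooth (cst c).
Proof.
move=> k; elim: k c => [|k IH] c /=; first by move=> p; exact: cst_continuous.
split=> [p|i]; first exact: differentiable_cst.
have -> : partial i (cst c) = cst 0 by apply/funext => p; exact: derive_cst.
exact: IH.
Qed.

Definition smooth_field (X : 'rV[R]_n -> 'rV[R]_n) : Prop :=
  forall i, smooth (fun p => X p 0 i).

End Smooth.

Section Differentiability.
Variables (R : realType) (V : normedModType R).

Lemma differentiable_bigsum (I : Type) (l : seq I) (P : pred I)
    (f : I -> V -> R) (x : V) :
  (forall i, P i -> differentiable (f i) x) ->
  differentiable (fun q => \sum_(i <- l | P i) f i q) x.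
Proof.
move=> df; elim: l => [|i l IH].
  have -> : (fun q => \sum_(i <- [::] | P i) f i q) = cst 0.
    by apply/funext => q; rewrite big_nil.
  exact: differentiable_cst.
case: (boolP (P i)) => Pi; last first.
  suff -> : (fun q => \sum_(j <- i :: l | P j) f j q) =
            (fun q => \sum_(j <- l | P j) f j q) by [].
  by apply/funext => q; rewrite big_cons (negbTE Pi).
have -> : (fun q => \sum_(j <- i :: l | P j) f j q) =
          f i + (fun q => \sum_(j <- l | P j) f j q).
  by apply/funext => q; rewrite big_cons Pi.
by apply: differentiableD => //; exact: df.
Qed.

Lemma differentiable_bigprod (I : Type) (l : seq I) (P : pred I)
    (f : I -> V -> R) (x : V) :
  (forall i, P i -> differentiable (f i) x) ->
  differentiable (fun q => \prod_(i <- l | P i) f i q) x.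
Proof.
move=> df; elim: l => [|i l IH].
  have -> : (fun q => \prod_(i <- [::] | P i) f i q) = cst 1.
    by apply/funext => q; rewrite big_nil.
  exact: differentiable_cst.
case: (boolP (P i)) => Pi; last first.
  suff -> : (fun q => \prod_(j <- i :: l | P j) f j q) =
            (fun q => \prod_(j <- l | P j) f j q) by [].
  by apply/funext => q; rewrite big_cons (negbTE Pi).
have -> : (fun q => \prod_(j <- i :: l | P j) f j q) =
          f i * (fun q => \prod_(j <- l | P j) f j q).
  by apply/funext => q; rewrite big_cons Pi.
by apply: differentiableM => //; exact: df.
Qed.

Lemma differentiable_mulr (f h : V -> R) (x : V) :
  differentiable f x -> differentiable h x ->
  differentiable (fun q => f q * h q) x.
Proof. exact: differentiableM. Qed.

Lemma differentiable_det n (A : V -> 'M[R]_n) (x : V) :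
  (forall i j, differentiable (fun q => A q i j) x) ->
  differentiable (fun q => \det (A q)) x.
Proof.
move=> dA; apply: differentiable_bigsum => s _.
apply: differentiable_mulr; first exact: (@differentiable_cst _ V R).
by apply: differentiable_bigprod => i _.
Qed.

Lemma differentiable_invmx n (A : V -> 'M[R]_n) (x : V) :
  (forall i j, differentiable (fun q => A q i j) x) ->
  (forall q, A q \in unitmx) ->
  forall i j, differentiable (fun q => invmx (A q) i j) x.
Proof.
move=> dA uA i j.
have -> : (fun q => invmx (A q) i j) =
          (fun q => (\det (A q))^-1 * \adj (A q) i j).
  by apply/funext => q; rewrite /invmx uA mxE.
apply: differentiable_mulr.
  apply: differentiableV; first exact: differentiable_det.
  by rewrite -unitfE -unitmxE.
have -> : (fun q => \adj (A q) i j) =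
          (fun q => (-1) ^+ (j + i) * \det (row' j (col' i (A q)))).
  by apply/funext => q; rewrite mxE.
apply: differentiable_mulr; first exact: (@differentiable_cst _ V R).
apply: differentiable_det => a b.
have -> : (fun q => row' j (col' i (A q)) a b) =
          (fun q => A q (lift j a) (lift i b)).
  by apply/funext => q; rewrite !mxE.
exact: dA.
Qed.

Lemma differentiable_row n (F : V -> 'rV[R]_n) (x : V) :
  (forall i, differentiable (fun q => F q 0 i) x) -> differentiable F x.
Proof.
move=> dF.
have -> : F = \sum_(i < n) (fun q => F q 0 i *: delta_mx 0 i).
  by apply/funext => q; rewrite fct_sumE; exact: row_sum_delta.
by apply: differentiable_sum => i; exact: differentiableZl.
Qed.

Lemma derivative_linear (W : normedModType R) (F : V -> W) (x : V) a u v :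
  differentiable F x -> 'D_(a *: u + v) F x = a *: 'D_u F x + 'D_v F x.
Proof. by move=> dF; rewrite !deriveE// linearP. Qed.

End Differentiability.

Section PseudoRiemannian.
Variables (R : realType) (n : nat).
Implicit Types (p x y z : 'rV[R]_n) (X Y Z : 'rV[R]_n -> 'rV[R]_n).

(* [P] is a change of basis to an orthonormal basis with [r] timelike and [s]
   spacelike vectors. *)
Definition has_signature (r s : nat) (G : 'M[R]_n) : Prop :=
  (r + s = n)%N /\
  exists2 P : 'M[R]_n, P \in unitmx &
    P *m G *m P^T = diag_mx (\row_(i < n) if (i < r)%N then -1 else 1).

Record pseudoRiemannian (r s : nat) := PseudoRiemannian {
  metric :> 'rV[R]_n -> 'M[R]_n;
  metric_smooth : forall i j, smooth (fun p => metric p i j);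
  metric_sym : forall p, (metric p)^T = metric p;
  metric_signature : forall p, has_signature r s (metric p) }.

Variables (r s : nat) (g : pseudoRiemannian r s).

Definition inner p x y : R := (x *m g p *m y^T) 0 0.

Definition christoffel (i j k : 'I_n) p : R :=
  2^-1 * \sum_(l < n) invmx (g p) k l *
    (partial i (fun q => g q j l) p + partial j (fun q => g q i l) p
     - partial l (fun q => g q i j) p).

Definition christoffel_map p x y : 'rV[R]_n :=
  \row_(k < n) \sum_(i < n) \sum_(j < n) christoffel i j k p * x 0 i * y 0 j.

(* The Levi-Civita connection in the global coordinates; [nabla_torsion_free]
   and [nabla_metric] are its two characteristic properties. *)
Definition nabla X Y : 'rV[R]_n -> 'rV[R]_n :=
  fun p => 'D_(X p) Y p + christoffel_map p (X p) (Y p).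

Definition lie_bracket X Y : 'rV[R]_n -> 'rV[R]_n :=
  fun p => 'D_(X p) Y p - 'D_(Y p) X p.

Definition curvature X Y Z : 'rV[R]_n -> 'rV[R]_n :=
  fun p => nabla X (nabla Y Z) p - nabla Y (nabla X Z) p
           - nabla (lie_bracket X Y) Z p.

(* The curvature is tensorial, so tangent vectors at [p] may be extended to
   constant vector fields. *)
Definition curvature_op p x y z : 'rV[R]_n :=
  curvature (cst x) (cst y) (cst z) p.

Definition jacobi p x : 'rV[R]_n -> 'rV[R]_n := fun y => curvature_op p y x x.

(* [jacobi p x] acts on row vectors by right multiplication by this matrix,
   see [jacobi_linear] and [jacobi_mxE]. *)
Definition jacobi_mx p x : 'M[R]_n := lin1_mx (jacobi p x).

(* The eigenvalues are the complex ones: as [g] is indefinite, the self-adjoint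
   operator [jacobi p x] may have non-real eigenvalues. [nilpotent_ossermanP] is
   the equivalent condition that the [n]-th power of [jacobi p x] vanish. *)
Definition nilpotent_osserman : Prop :=
  forall p x (a : R[i]),
    eigenvalue (map_mx (real_complex R) (jacobi_mx p x)) a -> a = 0.

Definition geodesic_on (I : set R) (c : R -> 'rV[R]_n) : Prop :=
  forall t, I t ->
    [/\ derivable c t 1, derivable (derive1 c) t 1 &
        derive1 (derive1 c) t +
        christoffel_map (c t) (derive1 c t) (derive1 c t) = 0].

Definition geodesically_complete : Prop :=
  forall (I : set R) (c : R -> 'rV[R]_n),
    open I -> is_interval I -> geodesic_on I c ->
    exists2 c' : R -> 'rV[R]_n, geodesic_on setT c' & {in I, c' =1 c}.

Lemma metric_unitmx p : g p \in unitmx.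
Proof.
have [_ [P _ eP]] := metric_signature g p.
have : \det (P *m g p *m P^T) != 0.
  rewrite eP det_diag prodf_seq_neq0; apply/allP => i _ /=.
  by rewrite mxE; case: ifP; rewrite ?oppr_eq0 oner_eq0.
by rewrite !det_mulmx !mulf_eq0 !negb_or unitmxE unitfE => /andP[/andP[]].
Qed.

Lemma differentiable_metric i j p : differentiable (fun q => g q i j) p.
Proof. by have [] := metric_smooth g i j 1. Qed.

Lemma differentiable_christoffel i j k p :
  differentiable (christoffel i j k) p.
Proof.
have dp a b c : differentiable (partial a (fun q => g q b c)) p.
  by have [_ /(_ a)[]] := metric_smooth g b c 2.
rewrite /christoffel; apply: differentiable_mulr.
  exact: (@differentiable_cst _ 'rV[R]_n R).
apply: differentiable_bigsum => l _; apply: differentiable_mulr.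
  by apply: differentiable_invmx => [a b|q];
    [exact: differentiable_metric|exact: metric_unitmx].
by apply: differentiableB => //; exact: differentiableD.
Qed.

Lemma differentiable_christoffel_map x y p :
  differentiable (fun q => christoffel_map q x y) p.
Proof.
apply: differentiable_row => k.
have -> : (fun q => christoffel_map q x y 0 k) = (fun q =>
    \sum_(i < n) \sum_(j < n) christoffel i j k q * x 0 i * y 0 j).
  by apply/funext => q; rewrite mxE.
apply: differentiable_bigsum => i _; apply: differentiable_bigsum => j _.
apply: differentiable_mulr; last exact: (@differentiable_cst _ 'rV[R]_n R).
apply: differentiable_mulr; last exact: (@differentiable_cst _ 'rV[R]_n R).
exact: differentiable_christoffel.
Qed.

Lemma christoffel_sym i j k p : christoffel i j k p = christoffel j i k p.
Proof.
rewrite /christoffel; congr (_ * _); apply: eq_bigr => l _.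
have -> : (fun q => g q i j) = (fun q => g q j i).
  by apply/funext => q; rewrite -[in LHS]metric_sym mxE.
by rewrite [X in _ * (X - _)]addrC.
Qed.

Lemma christoffel_map_sym p x y : christoffel_map p x y = christoffel_map p y x.
Proof.
apply/rowP => k; rewrite !mxE exchange_big; apply: eq_bigr => i _.
by apply: eq_bigr => j _; rewrite christoffel_sym mulrAC.
Qed.

Lemma christoffel_map_linearr p x a y z :
  christoffel_map p x (a *: y + z) =
  a *: christoffel_map p x y + christoffel_map p x z.
Proof.
apply/rowP => k; rewrite !mxE mulr_sumr -big_split; apply: eq_bigr => i _.
rewrite mulr_sumr -big_split; apply: eq_bigr => j _ /=.
by rewrite !mxE; ring.
Qed.

Lemma christoffel_map_linearl p a x y z :
  christoffel_map p (a *: x + y) z =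
  a *: christoffel_map p x z + christoffel_map p y z.
Proof.
by rewrite christoffel_map_sym christoffel_map_linearr !(christoffel_map_sym p z).
Qed.

Lemma christoffel_lower i j m p :
  \sum_(k < n) christoffel i j k p * g p k m = 2^-1 *
    (partial i (fun q => g q j m) p + partial j (fun q => g q i m) p
     - partial m (fun q => g q i j) p).
Proof.
pose c l := partial i (fun q => g q j l) p + partial j (fun q => g q i l) p
     - partial l (fun q => g q i j) p.
transitivity (2^-1 * ((\row_l c l) *m ((invmx (g p))^T *m g p)) 0 m); last first.
  by rewrite -{2}[g p]metric_sym -trmx_mul mulmxV ?metric_unitmx// trmx1 mulmx1 mxE.
rewrite mulmxA mxE mulr_sumr; apply: eq_bigr => k _.
rewrite /christoffel mulrA; congr (_ * _ * _).
by rewrite mxE; apply: eq_bigr => l _; rewrite !mxE mulrC.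
Qed.

Lemma nabla_torsion_free X Y p :
  nabla X Y p - nabla Y X p = lie_bracket X Y p.
Proof.
by rewrite /nabla /lie_bracket christoffel_map_sym opprD addrACA subrr addr0.
Qed.

Lemma derive_partial (f : 'rV[R]_n -> R) p x : differentiable f p ->
  'D_x f p = \sum_(i < n) x 0 i * partial i f p.
Proof.
move=> df; rewrite deriveE// [in LHS](row_sum_delta x) linear_sum.
by apply: eq_bigr => i _; rewrite linearZ /partial deriveE.
Qed.

Lemma innerE p x y :
  inner p x y = \sum_(j < n) \sum_(i < n) x 0 i * g p i j * y 0 j.
Proof.
rewrite /inner mxE; apply: eq_bigr => j _.
by rewrite !mxE mulr_suml.
Qed.

Lemma innerDl p x y z : inner p (x + y) z = inner p x z + inner p y z.
Proof. by rewrite /inner !mulmxDl mxE. Qed.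

Lemma inner_sym p x y : inner p x y = inner p y x.
Proof.
rewrite /inner -[in LHS](trmxK (x *m g p *m y^T)) mxE.
by rewrite !trmx_mul trmxK metric_sym mulmxA.
Qed.

Lemma innerDr p x y z : inner p x (y + z) = inner p x y + inner p x z.
Proof. by rewrite inner_sym innerDl !(inner_sym p x). Qed.

Lemma inner_christoffel_map p x y z :
  inner p (christoffel_map p x y) z + inner p y (christoffel_map p x z) =
  \sum_(j < n) \sum_(i < n) y 0 i * 'D_x (fun q => g q i j) p * z 0 j.
Proof.
pose c i j m := 2^-1 *
    (partial i (fun q => g q j m) p + partial j (fun q => g q i m) p
     - partial m (fun q => g q i j) p).
have E a b : inner p (christoffel_map p x a) b =
    \sum_(m < n) \sum_(j < n) \sum_(i < n) c i j m * x 0 i * a 0 j * b 0 m.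
  rewrite innerE; apply: eq_bigr => m _.
  transitivity (\sum_(k < n) \sum_(j < n) \sum_(i < n)
      christoffel i j k p * g p k m * (x 0 i * a 0 j * b 0 m)).
    apply: eq_bigr => k _; rewrite mxE exchange_big !mulr_suml.
    apply: eq_bigr => j _; rewrite !mulr_suml; apply: eq_bigr => i _; ring.
  rewrite exchange_big; apply: eq_bigr => j _.
  rewrite exchange_big; apply: eq_bigr => i _ /=.
  by rewrite -mulr_suml christoffel_lower /c; ring.
rewrite (inner_sym p y) !E [X in _ + X]exchange_big -big_split /=.
apply: eq_bigr => m _; rewrite -big_split; apply: eq_bigr => j _ /=.
rewrite derive_partial; last exact: differentiable_metric.
rewrite mulr_sumr mulr_suml -big_split; apply: eq_bigr => i _ /=.
have -> : c i j m = partial i (fun q => g q j m) p - c i m j.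
  rewrite /c; have -> : (fun q => g q m j) = (fun q => g q j m).
    by apply/funext => q; rewrite -[in LHS]metric_sym mxE.
  by field.
by ring.
Qed.

Lemma nabla_metric X Y Z p : smooth_field Y -> smooth_field Z ->
  'D_(X p) (fun q => inner q (Y q) (Z q)) p =
  inner p (nabla X Y p) (Z p) + inner p (Y p) (nabla X Z p).
Proof.
have dcoord (W : 'rV[R]_n -> 'rV[R]_n) : smooth_field W ->
    forall i, derivable (fun q => W q 0 i) p (X p).
  by move=> sW i; apply: diff_derivable; have [] := sW i 1.
have DW W i : smooth_field W ->
    ('D_(X p) W p) 0 i = 'D_(X p) (fun q => W q 0 i) p.
  move=> /dcoord dW; rewrite derive_mx ?mxE//; apply/derivable_mxP => a b.
  by rewrite (ord1 a).
move=> sY sZ; have dY := dcoord _ sY; have dZ := dcoord _ sZ.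
have dg i j : derivable (fun q => g q i j) p (X p).
  exact/diff_derivable/differentiable_metric.
transitivity (inner p ('D_(X p) Y p) (Z p) + inner p (Y p) ('D_(X p) Z p) +
  \sum_(j < n) \sum_(i < n)
    Y p 0 i * 'D_(X p) (fun q => g q i j) p * Z p 0 j); last first.
  rewrite -inner_christoffel_map /nabla !innerDl !innerDr.
  by rewrite addrACA.
pose t j i := (fun q => Y q 0 i) * (fun q => g q i j) * (fun q => Z q 0 j).
have -> : (fun q => inner q (Y q) (Z q)) = \sum_(j < n) \sum_(i < n) t j i.
  apply/funext => q; rewrite innerE fct_sumE; apply: eq_bigr => j _.
  by rewrite fct_sumE.
have dYg j i : derivable ((fun q => Y q 0 i) * (fun q => g q i j)) p (X p).
  exact: derivableM.
have dt j i : derivable (t j i) p (X p) by exact: derivableM.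
have dt' j : derivable (\sum_(i < n) t j i) p (X p).
  exact: (derivable_sum (dt j)).
rewrite (derive_sum dt').
rewrite !innerE -!big_split; apply: eq_bigr => j _ /=.
rewrite (derive_sum (dt j)) -!big_split; apply: eq_bigr => i _ /=.
rewrite /t deriveM// deriveM// !DW//= /GRing.scale /=.
have -> : ((fun q => Y q 0 i) * (fun q => g q i j)) p = Y p 0 i * g p i j by [].
by ring.
Qed.

Lemma curvature_opE p x y z :
  curvature_op p x y z =
  'D_x (fun q => christoffel_map q y z) p
    + christoffel_map p x (christoffel_map p y z)
  - ('D_y (fun q => christoffel_map q x z) p
    + christoffel_map p y (christoffel_map p x z)).
Proof.
have nc u v : nabla (cst u) (cst v) = (fun q => christoffel_map q u v).
  by apply/funext => q; rewrite /nabla derive_cst add0r.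
have n0 : nabla (lie_bracket (cst x) (cst y)) (cst z) p = 0.
  rewrite /nabla derive_cst add0r /lie_bracket !derive_cst subrr.
  apply/rowP => k; rewrite !mxE.
  by rewrite big1// => i _; rewrite big1// => j _; rewrite mxE mulr0 mul0r.
by rewrite /curvature_op /curvature n0 subr0 (nc x z) (nc y z).
Qed.

Lemma curvature_op_linearl p a x y w z :
  curvature_op p (a *: x + y) w z =
  a *: curvature_op p x w z + curvature_op p y w z.
Proof.
have rearrange (A B C D E F G H : 'rV[R]_n) :
    (a *: A + B) + (a *: C + D) - ((a *: E + F) + (a *: G + H)) =
    a *: (A + C - (E + G)) + (B + D - (F + H)).
  rewrite scalerBr !scalerDr (addrACA (a *: A)) (addrACA (a *: E)) opprD.
  by rewrite (addrACA (a *: A + _)).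
rewrite !curvature_opE -rearrange; congr (_ + _ - (_ + _)).
- by rewrite derivative_linear//; exact: differentiable_christoffel_map.
- exact: christoffel_map_linearl.
- have -> : (fun q => christoffel_map q (a *: x + y) z) =
      a *: (fun q => christoffel_map q x z) + (fun q => christoffel_map q y z).
    by apply/funext => q; rewrite christoffel_map_linearl.
  have dC u v t : derivable (fun q => christoffel_map q u v) p t.
    exact/diff_derivable/differentiable_christoffel_map.
  by rewrite deriveD; [rewrite deriveZ|exact: derivableZ|].
- by rewrite christoffel_map_linearl christoffel_map_linearr.
Qed.

Lemma jacobi_linear p x : linear (jacobi p x).
Proof. by move=> a y z; exact: curvature_op_linearl. Qed.

Lemma jacobi_mxE p x y : y *m jacobi_mx p x = jacobi p x y.
Proof.
pose L := GRing.isLinear.Build R 'rV[R]_n 'rV[R]_n *:%R (jacobi p x)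
  (@jacobi_linear p x).
pose J : {linear 'rV[R]_n -> 'rV[R]_n} := HB.pack (jacobi p x) L.
exact: (mul_rV_lin1 J).
Qed.

Lemma nilpotent_ossermanP :
  nilpotent_osserman <-> forall p x y, iter n (jacobi p x) y = 0.
Proof.
have iterE p x y k : iter k (jacobi p x) y = y *m iter k (mulmx (jacobi_mx p x)) 1%:M.
  elim: k y => [|k IH] y; first by rewrite mulmx1.
  by rewrite iterSr IH -jacobi_mxE mulmxA.
split=> [H p x y|H p x a].
- rewrite iterE.
  move: (jacobi_mx p x) (H p x) => A HA.
  case: n A y HA => [|m] A y HA; first by apply/rowP => -[].
  suff A0 : A ^+ m.+1 = 0.
    have powE k : iter k (mulmx A) 1%:M = A ^+ k.
      by elim: k => [//|k IH]; rewrite iterS IH exprS.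
    by rewrite powE A0 mulmx0.
  apply: (@map_mx_inj _ _ (real_complex R)).
  rewrite map_mx0 rmorphXn /=.
  set B := map_mx _ A in HA *.
  have [l El] := closed_field_poly_normal (char_poly B).
  rewrite (monicP (char_poly_monic B)) scale1r in El.
  have l0 : l = nseq (size l) 0.
    apply/all_pred1P/allP => z zl /=; apply/eqP/HA.
    by rewrite eigenvalue_root_char El root_prod_XsubC.
  have sl : size l = m.+1.
    by apply/succn_inj; rewrite -(size_char_poly B) El size_prod_XsubC.
  have XE : char_poly B = 'X^(m.+1).
    rewrite El l0 sl; elim: (m.+1) => [|k IH]; first by rewrite big_nil expr0.
    by rewrite /= big_cons subr0 IH exprS.
  by have := Cayley_Hamilton B; rewrite XE rmorphXn /= horner_mx_X.
- move=> /eigenvalueP[v Hv v0].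
  pose A := jacobi_mx p x; pose B := map_mx (real_complex R) A.
  have K k : v *m map_mx (real_complex R) (iter k (mulmx A) 1%:M) = a ^+ k *: v.
    elim: k => [|k IH]; first by rewrite map_mx1 mulmx1 expr0 scale1r.
    by rewrite iterS map_mxM mulmxA Hv -scalemxAl IH scalerA -exprS.
  have A0 : iter n (mulmx A) 1%:M = 0.
    by apply/row_matrixP => i; rewrite rowE -iterE H row0.
  have := K n; rewrite A0 map_mx0 mulmx0 => /esym/eqP.
  by rewrite scaler_eq0 (negbTE v0) orbF expf_eq0 => /andP[_ /eqP].
Qed.

End PseudoRiemannian.

Section Walker.
Variable R : realType.

(* Coordinates are indexed from 0: index [i] stands for [x_(i+1)]. *)
Definition depends_on_x3_x4 (f : 'rV[R]_4 -> R) : Prop :=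
  forall p q : 'rV[R]_4,
    p 0 (@Ordinal 4 2 isT) = q 0 (@Ordinal 4 2 isT) ->
    p 0 (@Ordinal 4 3 isT) = q 0 (@Ordinal 4 3 isT) ->
    f p = f q.

Variables psi33 psi34 psi44 : 'rV[R]_4 -> R.

Definition walker_mx (p : 'rV[R]_4) : 'M[R]_4 :=
  \matrix_(i < 4, j < 4)
    match val i, val j with
    | 0, 2 | 2, 0 | 1, 3 | 3, 1 => 1
    | 2, 2 => psi33 p
    | 2, 3 | 3, 2 => psi34 p
    | 3, 3 => psi44 p
    | _, _ => 0
    end.

Lemma walker_mx_sym p : (walker_mx p)^T = walker_mx p.
Proof.
by apply/matrixP => -[[|[|[|[]]]] //= i] [[|[|[|[]]]] //= j]; rewrite !mxE.
Qed.

Lemma walker_mx_signature p : has_signature 2 2 (walker_mx p).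
Proof.
split=> //.
pose P : 'M[R]_4 := \matrix_(i < 4, j < 4)
    match val i, val j with
    | 0, 0 => 1 + psi33 p / 4 | 0, 1 => psi34 p / 4 | 0, 2 => - 2^-1
    | 1, 0 => psi34 p / 4 | 1, 1 => 1 + psi44 p / 4 | 1, 3 => - 2^-1
    | 2, 0 => 1 - psi33 p / 4 | 2, 1 => - psi34 p / 4 | 2, 2 => 2^-1
    | 3, 0 => - psi34 p / 4 | 3, 1 => 1 - psi44 p / 4 | 3, 3 => 2^-1
    | _, _ => 0
    end.
have E : P *m walker_mx p *m P^T =
    diag_mx (\row_(i < 4) if (i < 2)%N then -1 else 1).
  pose Q : 'M[R]_4 := \matrix_(i < 4, j < 4)
    match val i, val j with
    | 0, 0 => - 2^-1 | 0, 2 => 1 - psi33 p / 4 | 0, 3 => - psi34 p / 4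
    | 1, 1 => - 2^-1 | 1, 2 => - psi34 p / 4 | 1, 3 => 1 - psi44 p / 4
    | 2, 0 => 2^-1 | 2, 2 => 1 + psi33 p / 4 | 2, 3 => psi34 p / 4
    | 3, 1 => 2^-1 | 3, 2 => psi34 p / 4 | 3, 3 => 1 + psi44 p / 4
    | _, _ => 0
    end.
  have -> : P *m walker_mx p = Q.
    apply/matrixP => -[[|[|[|[]]]] //= i] [[|[|[|[]]]] //= j];
      rewrite !(mxE, big_ord_recl, big_ord0) /=; by field.
  apply/matrixP => -[[|[|[|[]]]] //= i] [[|[|[|[]]]] //= j];
    rewrite !(mxE, big_ord_recl, big_ord0) /=; by field.
apply: (ex_intro2 _ _ P _ E).
have : \det (P *m walker_mx p *m P^T) != 0.
  rewrite E det_diag prodf_seq_neq0; apply/allP => i _ /=.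
  by rewrite mxE; case: ifP; rewrite ?oppr_eq0 oner_eq0.
by rewrite !det_mulmx !mulf_eq0 !negb_or unitmxE unitfE => /andP[/andP[]].
Qed.

Hypotheses (smooth33 : smooth psi33) (smooth34 : smooth psi34)
  (smooth44 : smooth psi44).

Lemma walker_mx_smooth i j : smooth (fun p => walker_mx p i j).
Proof.
move: i j => [[|[|[|[]]]] //= i] [[|[|[|[]]]] //= j].
all: under [X in smooth X]eq_fun do rewrite mxE /=.
all: try exact: smooth_cst.
all: by [].
Qed.

Definition walker : pseudoRiemannian R 4 2 2 :=
  PseudoRiemannian walker_mx_smooth walker_mx_sym walker_mx_signature.

End Walker.

(* Main.v *)
Require Import Defs.
From mathcomp Require Import all_boot all_order all_algebra.
From mathcomp Require Import all_classical all_reals all_analysis.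
From mathcomp Require Import ring lra.

(** The planes on which [x_3] and [x_4] are constant form a foliation by totally
    null surfaces, and the metric is constant along each leaf.  Everything
    follows from the shape of the Christoffel symbols.  Lowering the upper
    index, [Gamma_ijm] is a combination of derivatives of components of [g], and
    such a derivative vanishes as soon as one of its three indices is [1] or
    [2].  The metric pairs [d_1] with [d_3] and [d_2] with [d_4], so after
    raising the index again:
    - [Gamma(x, y)] sees only the components of [x] and [y] transverse to the
      leaves ([christoffel_walker_null]);
    - [Gamma(x, y)] is tangent to the leaves ([christoffel_walker_vertical]);
    - the coefficients depend on [(x_3, x_4)] only.

    Nilpotency.  The products [Gamma Gamma] in the curvature vanish, so the
    Jacobi operator is
    [J(x) y = D_y Gamma(x, x) - D_x Gamma(y, x)].  Its values are tangent to the
    leaves, and it kills the vectors [y] tangent to the leaves; hence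
    [J(x)^2 = 0].

    Completeness.  In the geodesic equation, the transverse components satisfy
    [c_3'' = c_4'' = 0], and thus continue to affine functions on the whole
    line.  Once they are known, the two other equations read
    [c_i'' = - Gamma_i(c_3, c_4, c_3', c_4')], where the right-hand side is a
    known continuous function of time on the whole line: they are solved by two
    successive primitives ([extend_second_primitive]). *)

Set Implicit Arguments.
Unset Strict Implicit.
Unset Printing Implicit Defensive.

Import Order.TTheory GRing.Theory Num.Theory.
Import numFieldNormedType.Exports.

Local Open Scope classical_set_scope.
Local Open Scope ring_scope.

(** * Global primitives on the real line *)

Section Primitives.
Variable R : realType.
Implicit Types (f u : R -> R) (I : set R).
Notation mu := (@lebesgue_measure R).

Lemma continuous_integrable_itv f (a b : R) : continuous f ->
  mu.-integrable `[a, b] (EFin \o f).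
Proof.
move=> cf; apply: continuous_compact_integrable; first exact: segment_compact.
exact: continuous_subspaceT.
Qed.

Lemma Rintegral_change_base f (a b x : R) : continuous f -> a <= b -> b <= x ->
  \int[mu]_(t in `[a, x]) f t =
  \int[mu]_(t in `[a, b]) f t + \int[mu]_(t in `[b, x]) f t.
Proof.
move=> cf ab bx; apply/eqP; rewrite addrC -subr_eq; apply/eqP.
rewrite Rintegral_itvB ?bnd_simp//; last exact: continuous_integrable_itv.
apply: Rintegral_itv_obnd_cbnd.
apply: integrableS (continuous_integrable_itv b x cf) => //.
exact: subset_itv_oc_cc.
Qed.

(** The integral from a fixed base point [a] is an antiderivative only to the
    right of [a]. The base point therefore moves to the left with [x], and
    subtracting the value at [0] makes the result independent of it. *)
Lemma exists_primitive f : continuous f ->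
  exists F : R -> R, forall x : R, is_derive x (1 : R) F (f x).
Proof.
move=> cf; pose P (a x : R) := \int[mu]_(t in `[a, x]) f t.
have indep a b x : a <= b -> b <= 0 -> b <= x -> P a x - P a 0 = P b x - P b 0.
  move=> ab b0 bx; rewrite /P (Rintegral_change_base cf ab bx).
  by rewrite (Rintegral_change_base cf ab b0); ring.
pose F x := P (- (`|x| + 1)) x - P (- (`|x| + 1)) 0.
exists F => x.
(* Near [x] this single base point lies to the left of all those used by [F]. *)
pose a := - (`|x| + 2).
have ax : a < x by rewrite /a; have := ler_norm (- x); rewrite normrN; lra.
have dP : is_derive x (1 : R) (P a) (f x).
  have xx1 : x < x + 1 by rewrite ltrDl.
  have [dPx Px] :=
    continuous_FTC1_closed xx1 (continuous_integrable_itv _ _ cf) ax (cf x).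
  by rewrite -Px derive1E; exact: derivableP.
apply: (@near_eq_is_derive _ _ _ (P a - cst (P a 0))); last first.
  by rewrite -[f x]subr0; exact: is_deriveB.
near=> y.
have yx : `|y| < `|x| + 1.
  have : `|x - y| < 1 by near: y; apply/nbhs_ballP; exists 1 => //=.
  have := ler_normD x (y - x); rewrite addrC subrK [`|y - x|]distrC; lra.
rewrite /F/=; change (P a y - P a 0 = F y).
apply: indep; rewrite /a.
- by have := normr_ge0 y; lra.
- by have := normr_ge0 y; lra.
- by have := ler_norm (- y); rewrite normrN; lra.
Unshelve. all: by end_near. Qed.

Lemma is_interval_itvcc I (a b x : R) : is_interval I -> I a -> I b ->
  x \in `[a, b] -> I x.
Proof. by move=> iI Ia Ib; rewrite in_itv/=; exact: iI. Qed.

Lemma derive0_interval_cst I u : is_interval I ->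
  (forall t, I t -> is_derive t (1 : R) u 0) ->
  forall s t, I s -> I t -> u s = u t.
Proof.
move=> iI du s t.
wlog st : s t / s <= t.
  by move=> H Is It; case: (leP s t) => [/H|/ltW /H] ->.
move=> Is It.
have d z : z \in `[s, t] -> is_derive z (1 : R) u 0.
  by move=> zst; apply/du/(is_interval_itvcc iI Is It zst).
have d' z : z \in `]s, t[ -> is_derive z (1 : R) u (cst 0 z).
  by move=> zst; apply: d; exact: subset_itv_oo_cc zst.
have cu : {within `[s, t], continuous u}.
  by apply: derivable_within_continuous => z zst; have [] := d z zst.
have [c _] := MVT_segment st d' cu.
by rewrite mul0r => /eqP; rewrite subr_eq0 => /eqP.
Qed.

(** A solution on [I] of [u' = f], with [f] defined on the whole line, extends
    to the whole line: on an interval it differs from a global primitive of [f]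
    by a constant. *)
Lemma extend_primitive I u f : is_interval I -> continuous f ->
  (forall t, I t -> is_derive t (1 : R) u (f t)) ->
  exists2 v : R -> R, (forall t, is_derive t (1 : R) v (f t)) &
    forall t, I t -> v t = u t.
Proof.
move=> iI cf du; have [F dF] := exists_primitive cf.
have [[s Is]|I0] := pselect (exists s, I s); last first.
  by exists F => // t It; case: I0; exists t.
exists (F - cst (F s - u s)) => [t|t It].
  by rewrite -[f t]subr0; exact: is_deriveB.
have E : F s - u s = F t - u t.
  apply: (derive0_interval_cst (u := F - u) iI) Is It => z Iz.
  by rewrite -(subrr (f z)); apply: is_deriveB; exact: du.
by change (F t - (F s - u s) = u t); rewrite E subKr.
Qed.

(** In the pair [vw], the second function is the derivative of the first: both
    the extension of [u] and its velocity are recorded, so that [vw.2] can be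
    fed to other equations. *)
Lemma extend_second_primitive I u f : is_interval I -> continuous f ->
  (forall t, I t -> derivable u t 1) ->
  (forall t, I t -> is_derive t (1 : R) (derive1 u) (f t)) ->
  exists vw : (R -> R) * (R -> R),
    [/\ forall t, is_derive t (1 : R) vw.1 (vw.2 t),
        forall t, is_derive t (1 : R) vw.2 (f t) &
        forall t, I t -> vw.1 t = u t /\ vw.2 t = derive1 u t].
Proof.
move=> iI cf du ddu.
have [w dw wu] := extend_primitive iI cf ddu.
have cw : continuous w.
  by move=> t; apply/differentiable_continuous/derivable1_diffP/ex_derive.
have [t It|v dv vu] := @extend_primitive I u w iI cw.
  by rewrite wu// derive1E; apply/derivableP/du.
by exists (v, w); split => // t It; split; [exact: vu|exact: wu].
Qed.

End Primitives.

(** * Derivatives of curves by components *)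

Section Rows.
Variable R : realType.

Lemma is_derive_row n (F : R -> 'rV[R]_n) (G : 'rV[R]_n) (t : R) :
  (forall i, is_derive t (1 : R) (fun s => F s 0 i) (G 0 i)) ->
  is_derive t (1 : R) F G.
Proof.
move=> dF.
have dFt : derivable F t 1.
  by apply/derivable_mxP => i j; rewrite (ord1 i); exact: ex_derive.
apply: DeriveDef => //; rewrite derive_mx//; apply/rowP => i; rewrite mxE.
exact: derive_val.
Qed.

Lemma is_derive_entry n (F : R -> 'rV[R]_n) (G : 'rV[R]_n) (t : R) i :
  is_derive t (1 : R) F G -> is_derive t (1 : R) (fun s => F s 0 i) (G 0 i).
Proof.
move=> [dF <-]; rewrite derive_mx// mxE; apply: derivableP.
by move/derivable_mxP : dF; exact.
Qed.

End Rows.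

(** * Functions constant along the null leaves *)

Section NullLeaves.
Variable R : realType.
Implicit Types (p q v x y z : 'rV[R]_4).

(** Coordinates count from [0], so the indices [2] and [3] are the ones
    transverse to the null leaves. Applied to tangent vectors,
    [same_leaf v 0] says that [v] is tangent to the leaves. *)
Definition same_leaf p q := forall i : 'I_4, (2 <= i)%N -> p 0 i = q 0 i.

Definition leaf_invariant (T : Type) (F : 'rV[R]_4 -> T) :=
  forall p q, same_leaf p q -> F p = F q.

Lemma leaf_invariant_depends_on_x3_x4 (f : 'rV[R]_4 -> R) :
  depends_on_x3_x4 f -> leaf_invariant f.
Proof. by move=> df p q pq; apply: df; exact: pq. Qed.

Lemma leaf_invariant_derive (f : 'rV[R]_4 -> R) v :
  leaf_invariant f -> leaf_invariant (fun p => 'D_v f p).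
Proof.
move=> fi p q pq; rewrite /derive.
suff -> : (fun h : R => h^-1 *: ((f \o shift p) (h *: v) - f p)) =
          (fun h : R => h^-1 *: ((f \o shift q) (h *: v) - f q)) by [].
apply/funext => h /=; rewrite (fi _ _ pq).
by rewrite (fi (h *: v + p) (h *: v + q))// => i i2; rewrite !mxE pq.
Qed.

Lemma derive_along_leaf (W : normedModType R) (F : 'rV[R]_4 -> W) p v :
  leaf_invariant F -> same_leaf v 0 -> 'D_v F p = 0.
Proof.
move=> Fi v0; rewrite /derive.
suff -> : (fun h : R => h^-1 *: ((F \o shift p) (h *: v) - F p)) = cst 0.
  exact: lim_cst.
apply/funext => h /=; rewrite (Fi (h *: v + p) p) ?subrr ?scaler0//.
by move=> i i2; rewrite !mxE v0// mxE mulr0 add0r.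
Qed.

End NullLeaves.

(** * The Christoffel symbols of a Walker metric *)

Section WalkerGeometry.
Variables (R : realType) (psi33 psi34 psi44 : 'rV[R]_4 -> R).
Hypotheses (smooth33 : smooth psi33) (smooth34 : smooth psi34)
  (smooth44 : smooth psi44).
Hypotheses (inv33 : leaf_invariant psi33) (inv34 : leaf_invariant psi34)
  (inv44 : leaf_invariant psi44).
Implicit Types (p q x y z : 'rV[R]_4).

Let M := walker smooth33 smooth34 smooth44.

Lemma walker_leaf_invariant : leaf_invariant M.
Proof.
move=> p q pq; apply/matrixP => i j; rewrite !mxE.
by rewrite (inv33 pq) (inv34 pq) (inv44 pq).
Qed.

(** Non-constant components of the metric have both indices transverse, and they
    do not vary in the leaf directions. *)
Lemma partial_walker_eq0 (i j k : 'I_4) p :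
  [|| (i < 2)%N, (j < 2)%N | (k < 2)%N] -> partial i (fun q => M q j k) p = 0.
Proof.
case: (ltnP i 2) => [i2 _|_ /= jk].
  apply: derive_along_leaf => [q r qr|l l2].
    by rewrite (walker_leaf_invariant qr).
  by rewrite !mxE; case: (eqVneq l i) => [li|//]; rewrite -li ltnNge l2 in i2.
suff [a Ea] : exists a : R, (fun q => M q j k) = cst a.
  by rewrite Ea; exact: derive_cst.
by case: j k jk => [[|[|[|[]]]] //= ?] [[|[|[|[]]]] //= ?] _;
  eexists; apply/funext => q; rewrite mxE.
Qed.

(** Lowering the upper index [k] of a transverse direction turns it into the
    index [m = k - 2] of the leaf direction paired with it by the metric; by
    [christoffel_lower] this avoids computing the inverse of the metric. *)
Lemma christoffel_walker_vertical (i j k : 'I_4) p : (2 <= k)%N ->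
  christoffel M i j k p = 0.
Proof.
move=> k2.
have [m mE] : exists m : 'I_4, (k = m + 2 :> nat)%N.
  have k4 : (k - 2 < 4)%N by rewrite (leq_ltn_trans (leq_subr _ _)).
  by exists (Ordinal k4); rewrite /= subnK.
have m2 : (m < 2)%N by rewrite -(ltn_add2r 2) -mE.
(* A leaf direction has a nonzero product only with the direction paired
   with it. *)
have gE (l : 'I_4) : M p l m = (l == k)%:R.
  rewrite mxE -val_eqE /= mE.
  by case: l m m2 {mE} => [[|[|[|[]]]] //= ?] [[|[]] //= ?] _.
transitivity (\sum_(l < 4) christoffel M i j l p * M p l m).
  rewrite (bigD1 k)//= gE eqxx mulr1 big1 ?addr0// => l lk.
  by rewrite gE (negbTE lk) mulr0.
rewrite christoffel_lower !partial_walker_eq0 ?m2 ?orbT//.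
by rewrite addr0 subr0 mulr0.
Qed.

Lemma christoffel_walker_null (i j k : 'I_4) p : (i < 2)%N || (j < 2)%N ->
  christoffel M i j k p = 0.
Proof.
wlog i2 : i j / (i < 2)%N.
  move=> H /[dup] + /orP[i2|j2]; first exact: H.
  by rewrite christoffel_sym orbC; exact: H.
move=> _; rewrite /christoffel big1 ?mulr0// => l _.
by rewrite !partial_walker_eq0 ?i2 ?orbT// addr0 subr0 mulr0.
Qed.

Lemma christoffel_leaf_invariant (i j k : 'I_4) :
  leaf_invariant (christoffel M i j k).
Proof.
move=> p q pq; rewrite /christoffel; congr (_ * _); apply: eq_bigr => l _.
have inv a b : leaf_invariant (fun r => M r a b).
  by move=> r s rs; rewrite (walker_leaf_invariant rs).
rewrite (walker_leaf_invariant pq); congr (_ * (_ + _ - _));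
  exact: leaf_invariant_derive (inv _ _) _ _ pq.
Qed.

Lemma christoffel_map_leafwise p p' x x' y y' :
  same_leaf p p' -> same_leaf x x' -> same_leaf y y' ->
  christoffel_map M p x y = christoffel_map M p' x' y'.
Proof.
move=> pp xx yy; apply/rowP => k; rewrite !mxE.
apply: eq_bigr => i _; apply: eq_bigr => j _.
rewrite (christoffel_leaf_invariant _ _ _ pp).
case: (ltnP i 2) => i2; first by rewrite christoffel_walker_null ?i2// !mul0r.
case: (ltnP j 2) => j2.
  by rewrite christoffel_walker_null ?j2 ?orbT// !mul0r.
by rewrite xx// yy.
Qed.

Lemma christoffel_map_tangent p x y : same_leaf (christoffel_map M p x y) 0.
Proof.
move=> k k2; rewrite !mxE big1// => i _; rewrite big1// => j _.
by rewrite christoffel_walker_vertical// !mul0r.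
Qed.

Lemma christoffel_map0r p x : christoffel_map M p x 0 = 0.
Proof.
apply/rowP => k; rewrite !mxE big1// => i _; rewrite big1// => j _.
by rewrite mxE mulr0.
Qed.

Lemma christoffel_map_tangentr p x y :
  same_leaf y 0 -> christoffel_map M p x y = 0.
Proof.
by move=> y0; rewrite (@christoffel_map_leafwise p p x x y 0)// christoffel_map0r.
Qed.

(** * The Jacobi operator *)

(** The quadratic terms of the curvature vanish because the values of
    [christoffel_map] are tangent to the leaves, a direction that it ignores. *)
Lemma jacobi_walkerE p x y : jacobi M p x y =
  'D_y (fun q => christoffel_map M q x x) p
  - 'D_x (fun q => christoffel_map M q y x) p.
Proof.
rewrite /jacobi curvature_opE.
by rewrite !(christoffel_map_tangentr _ _ (christoffel_map_tangent _ _ _)) !addr0.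
Qed.

Lemma derive_tangent (F : 'rV[R]_4 -> 'rV[R]_4) p v :
  differentiable F p -> (forall q, same_leaf (F q) 0) -> same_leaf ('D_v F p) 0.
Proof.
move=> dF F0 i i2; rewrite derive_mx ?mxE; last exact: diff_derivable.
have -> : (fun q => F q 0 i) = cst 0 by apply/funext => q; rewrite F0// mxE.
exact: derive_cst.
Qed.

Lemma jacobi_walker_tangent p x y : same_leaf (jacobi M p x y) 0.
Proof.
move=> i i2; rewrite jacobi_walkerE [LHS]mxE [X in _ + X]mxE.
rewrite !derive_tangent ?mxE ?subr0//.
all: try by move=> q; exact: christoffel_map_tangent.
all: exact: differentiable_christoffel_map.
Qed.

(** For [y] tangent to the leaves, the Christoffel symbols do not vary along [y],
    and [christoffel_map q y x] vanishes for all [q]. *)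
Lemma jacobi_walker_null p x y : same_leaf y 0 -> jacobi M p x y = 0.
Proof.
move=> y0; rewrite jacobi_walkerE derive_along_leaf// => [|q r qr]; last first.
  exact: christoffel_map_leafwise.
have -> : (fun q => christoffel_map M q y x) = cst 0.
  by apply/funext => q; rewrite christoffel_map_sym christoffel_map_tangentr.
by rewrite derive_cst subr0.
Qed.

(** The image of the Jacobi operator consists of leaf directions and these lie in
    its kernel, so already its square is zero. *)
Lemma walker_nilpotent_osserman : nilpotent_osserman M.
Proof.
apply/nilpotent_ossermanP => p x y /=.
exact/jacobi_walker_null/jacobi_walker_tangent.
Qed.

(** * Geodesics *)

Lemma continuous_christoffel_map_along (p x : R -> 'rV[R]_4) i :
  (forall t, differentiable p t) -> (forall t, differentiable x t) ->
  continuous (fun t => christoffel_map M (p t) (x t) (x t) 0 i).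
Proof.
move=> dp dx t; apply: differentiable_continuous.
have -> : (fun t => christoffel_map M (p t) (x t) (x t) 0 i) = (fun t =>
    \sum_(j < 4) \sum_(k < 4) christoffel M j k i (p t) * x t 0 j * x t 0 k).
  by apply/funext => s; rewrite mxE.
have dxj j : differentiable (fun s => x s 0 j) t.
  apply/derivable1_diffP; move/derivable1_diffP/derivable_mxP : (dx t); exact.
apply: differentiable_bigsum => j _; apply: differentiable_bigsum => k _.
apply: differentiable_mulr => //; apply: differentiable_mulr => //.
apply: (@differentiable_comp _ _ _ _ p (christoffel M j k i)) => //.
exact: differentiable_christoffel.
Qed.

(** The geodesic equations decouple in a triangular way: the transverse
    components are extended first, and they determine the right-hand sides of the
    equations for the leaf components. *)
Lemma walker_geodesically_complete : geodesically_complete M.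
Proof.
move=> I c oI iI gc.
pose u i t := c t 0 i.
have dc t : I t -> is_derive t (1 : R) c (derive1 c t).
  by move=> /gc[dct _ _]; rewrite derive1E; exact/derivableP.
have du i t : I t -> is_derive t (1 : R) (u i) (derive1 c t 0 i).
  by move=> /dc; exact: is_derive_entry.
have u'E i t : I t -> derive1 (u i) t = derive1 c t 0 i.
  by move=> /(du i) dut; rewrite derive1E; exact: derive_val.
have ddu i t : I t -> is_derive t (1 : R) (derive1 (u i))
    (- christoffel_map M (c t) (derive1 c t) (derive1 c t) 0 i).
  (* The velocities of the components are entries of [derive1 c] only on [I],
     which suffices to differentiate them as [I] is open. *)
  move=> It; apply: (@near_eq_is_derive _ _ _ (fun s => derive1 c s 0 i)).
    by near do rewrite u'E//; exact: open_nbhs_nbhs.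
  have [_ ddc /eqP] := gc t It.
  rewrite addr_eq0 derive1E => /eqP E.
  have : is_derive t (1 : R) (derive1 c)
      (- christoffel_map M (c t) (derive1 c t) (derive1 c t)).
    by rewrite -E; exact/derivableP.
  by move=> /(is_derive_entry i); rewrite mxE.
(* The transverse components have zero acceleration; [a] extends them together
   with their velocities. In the leaf components any affine function would do:
   they matter only for the regularity of the curve [p] below. *)
have /choice[a aP] : forall i : 'I_4, exists vw : (R -> R) * (R -> R),
    [/\ forall t, is_derive t (1 : R) vw.1 (vw.2 t),
        forall t, is_derive t (1 : R) vw.2 0 &
        (2 <= i)%N ->
        forall t, I t -> vw.1 t = u i t /\ vw.2 t = derive1 (u i) t].
  move=> i; case: (ltnP i 2) => [i2|i2].
    by exists (cst 0, cst 0); split => [t|t|//]; exact: is_derive_cst.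
  have [|t It|t It|vw [dv dw vwE]] :=
    @extend_second_primitive R I (u i) (cst 0) iI.
  - exact: cst_continuous.
  - by have [] := du i t It.
  - have := ddu i t It; rewrite christoffel_map_tangent ?mxE ?oppr0//.
  - by exists vw; split.
(* The curve [p] is not the geodesic, but it passes through the same leaves at
   the same times: it carries the data on which the Christoffel term depends. *)
pose p t : 'rV[R]_4 := \row_i (a i).1 t.
pose x t : 'rV[R]_4 := \row_i (a i).2 t.
pose f i t := - christoffel_map M (p t) (x t) (x t) 0 i.
have dp t : is_derive t (1 : R) p (x t).
  apply: is_derive_row => i; rewrite mxE.
  have -> : (fun s => p s 0 i) = (a i).1 by apply/funext => s; rewrite mxE.
  by have [] := aP i.
have dx t : is_derive t (1 : R) x 0.
  apply: is_derive_row => i; rewrite mxE.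
  have -> : (fun s => x s 0 i) = (a i).2 by apply/funext => s; rewrite mxE.
  by have [] := aP i.
have cf i : continuous (f i).
  move=> t; apply: continuousN; apply: continuous_christoffel_map_along => {}t.
  - by apply/derivable1_diffP; have [] := dp t.
  - by apply/derivable1_diffP; have [] := dx t.
have fE i t : I t ->
    - christoffel_map M (c t) (derive1 c t) (derive1 c t) 0 i = f i t.
  move=> It.
  have cp : same_leaf (c t) (p t).
    by move=> j j2; have [_ _ /(_ j2 t It)[pE _]] := aP j; rewrite mxE pE.
  have cx : same_leaf (derive1 c t) (x t).
    by move=> j j2; have [_ _ /(_ j2 t It)[_ xE]] := aP j; rewrite mxE xE u'E.
  by rewrite /f (christoffel_map_leafwise cp cx cx).
(* With the right-hand side [f] now defined for all times, all the components
   extend; the transverse ones stay those of [p]. *)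
have /choice[b bP] : forall i : 'I_4, exists vw : (R -> R) * (R -> R),
    [/\ forall t, is_derive t (1 : R) vw.1 (vw.2 t),
        forall t, is_derive t (1 : R) vw.2 (f i t),
        forall t, I t -> vw.1 t = u i t &
        (2 <= i)%N -> vw = a i].
  move=> i; case: (ltnP i 2) => [i2|i2].
    have [t It|t It|vw [dv dw vwE]] :=
      @extend_second_primitive R I (u i) (f i) iI (cf i).
    - by have [] := du i t It.
    - by rewrite -fE//; exact: ddu.
    - by exists vw; split => // t /vwE[].
  have [dv dw /(_ i2) vwE] := aP i; exists (a i).
  split=> // t; last by move=> /vwE[].
  by rewrite /f christoffel_map_tangent// mxE oppr0.
pose c' t : 'rV[R]_4 := \row_i (b i).1 t.
pose w t : 'rV[R]_4 := \row_i (b i).2 t.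
have dc' t : is_derive t (1 : R) c' (w t).
  apply: is_derive_row => i; rewrite mxE.
  have -> : (fun s => c' s 0 i) = (b i).1 by apply/funext => s; rewrite mxE.
  by have [] := bP i.
have dw t : is_derive t (1 : R) w (- christoffel_map M (p t) (x t) (x t)).
  apply: is_derive_row => i; rewrite mxE.
  have -> : (fun s => w s 0 i) = (b i).2 by apply/funext => s; rewrite mxE.
  by have [] := bP i.
have c'E : derive1 c' = w.
  by apply/funext => t; rewrite derive1E; exact: derive_val.
exists c' => [t _|t]; last first.
  by rewrite inE => It; apply/rowP => i; rewrite mxE; have [_ _ ->] := bP i.
split; first exact: ex_derive.
  by rewrite c'E; exact: ex_derive.
rewrite c'E derive1E derive_val; apply/eqP; rewrite addrC subr_eq0; apply/eqP.
apply: christoffel_map_leafwise => i i2; rewrite !mxE.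
all: by have [_ _ _ ->] := bP i.
Unshelve. all: by end_near. Qed.

End WalkerGeometry.

Theorem theorem3p1 (R : realType) (psi33 psi34 psi44 : 'rV[R]_4 -> R)
    (smooth33 : smooth psi33) (smooth34 : smooth psi34)
    (smooth44 : smooth psi44)
    (dep33 : depends_on_x3_x4 psi33) (dep34 : depends_on_x3_x4 psi34)
    (dep44 : depends_on_x3_x4 psi44) :
  let M := walker smooth33 smooth34 smooth44 in
  nilpotent_osserman M /\ geodesically_complete M.
Proof.
have inv33 := leaf_invariant_depends_on_x3_x4 dep33.
have inv34 := leaf_invariant_depends_on_x3_x4 dep34.
have inv44 := leaf_invariant_depends_on_x3_x4 dep44.
split; first exact: walker_nilpotent_osserman.
exact: walker_geodesically_complete.
Qed.
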